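(* Suppose $\langle A_{\alpha}^{m} : \alpha < \omega_{1},\ m \in \omega \rangle$ is a $\clubsuit_{F}$-sequence. Then there is a regular topology $\tau$ on the set $\omega_1$ such that $(\omega_1,\tau) \rightarrow (top\ \omega+1)^{1}_{\omega}$, $(\omega_{1},\tau) \nrightarrow (top\ \omega^{2}+1)^{1}_{\omega}$, and for every nonzero limit ordinal $\alpha \in \omega_{1}$ and every $m \in \omega$ there exists an increasing sequence (of length $\omega$) of ordinals in $A_{\alpha}^{m}$ converging to $\alpha$ in $(\omega_1,\tau)$.
   Context: For a topological space $X$ and an ordinal $\alpha$, $X \rightarrow (top\ \alpha)^{1}_{\omega}$ means: for every function $f: X \to \omega$ there are $n \in \omega$ and $Y \subseteq f^{-1}[\{n\}]$ such that $Y$ (with the subspace topology) is homeomorphic to $\alpha$ with the order topology; $\nrightarrow$ denotes the negation. Here $\omega^2$ is ordinal exponentiation. $\operatorname{acc}(\omega_1)$ denotes the set of nonzero limit ordinals below $\omega_1$. A sequence $\langle A_\alpha^n:\alpha<\omega_1,\ n<\omega\rangle$ is a $\clubsuit_F$-sequence if (1) for all $\alpha\in\operatorname{acc}(\omega_1)$ and $n\in\omega$, $A_\alpha^n$ is an unbounded subset of $\alpha$; and (2) for every $f:\omega_1\to\omega$ there are $\alpha\in\operatorname{acc}(\omega_1)$ and $n,m\in\omega$ such that $\alpha\in f^{-1}[\{n\}]$ and $A_\alpha^m\subseteq f^{-1}[\{n\}]$. Regular spaces are assumed $T_1$. *)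

(* Defs.v *)
From HB Require Import structures.
From mathcomp Require Import all_boot all_order.
From mathcomp Require Import boolp classical_sets functions cardinality wochoice.
From mathcomp Require Import topology.

Set Implicit Arguments.
Unset Strict Implicit.
Unset Printing Implicit Defensive.

Import Order.TTheory.
Local Open Scope classical_set_scope.
Local Open Scope order_scope.

(** The order type T + 1: [None] is a new element placed above all of T. *)
Definition osucc (T : Type) : Type := option T.

Section OSuccOrder.
Context {d : Order.disp_t} {T : orderType d}.

Definition osucc_le (x y : osucc T) : bool :=
  match x, y with
  | _, None => true
  | None, Some _ => false
  | Some a, Some b => a <= b
  end.

Lemma osucc_le_refl : reflexive osucc_le.
Proof. by case=> [a|] //=. Qed.

Lemma osucc_le_anti : antisymmetric osucc_le.
Proof. by case=> [a|] [b|] //= /le_anti ->. Qed.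

Lemma osucc_le_trans : transitive osucc_le.
Proof. by case=> [b|] [a|] [c|] //=; apply: le_trans. Qed.

Lemma osucc_le_total : total osucc_le.
Proof. by case=> [a|] [b|] //=; apply: le_total. Qed.

HB.instance Definition _ := Choice.copy (osucc T) (option T).
HB.instance Definition _ := Order.Le_isPOrder.Build d (osucc T)
  osucc_le_refl osucc_le_anti osucc_le_trans.
HB.instance Definition _ :=
  Order.POrder_isTotal.Build d (osucc T) osucc_le_total.

End OSuccOrder.

(** omega + 1 and omega ^ 2 + 1, where omega ^ 2 = omega * omega consists of
    omega consecutive copies of omega: in [nat *l nat] the first component is
    the most significant one. *)
Definition omega_plus_1 := osucc nat.
Definition omega_sq_plus_1 := osucc (nat *l nat).
HB.instance Definition _ := Order.Total.on omega_plus_1.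
HB.instance Definition _ := Order.Total.on omega_sq_plus_1.

Definition homeomorphic (X Y : topologicalType) : Prop :=
  exists (f : X -> Y) (g : Y -> X),
    [/\ cancel f g, cancel g f, continuous f & continuous g].

(** X -> (top alpha)^1_omega; a subset Y of X, used as a type, carries the
    subspace topology. *)
Definition top_arrow (X : topologicalType) {d : Order.disp_t}
    (alpha : orderType d) : Prop :=
  forall f : X -> nat, exists (n : nat) (Y : set X),
    Y `<=` f @^-1` [set n] /\ homeomorphic Y (order_topology alpha).

Record topology_on (T : Type) := TopologyOn {
  topen : set (set T);
  topenT : topen setT;
  topenI : forall U V, topen U -> topen V -> topen (U `&` V);
  topen_bigU : forall F : set (set T),
    F `<=` topen -> topen (\bigcup_(U in F) U) }.

Definition space (T : Type) (tau : topology_on T) : Type := T.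

Section SpaceTopology.
Context {T : choiceType} (tau : topology_on T).

Lemma topen_bigcup (I : Type) (f : I -> set T) :
  (forall i, topen tau (f i)) -> topen tau (\bigcup_i f i).
Proof.
move=> fop.
suff -> : \bigcup_i f i = \bigcup_(U in range f) U.
  by apply: topen_bigU => _ [i _ <-].
by rewrite bigcup_image.
Qed.

HB.instance Definition _ := Choice.copy (space tau) T.
HB.instance Definition _ := isOpenTopological.Build (space tau)
  (topenT tau) (@topenI _ tau) topen_bigcup.

End SpaceTopology.

(** In the library, [regular_space] does not include T1. *)
Definition regular_T1 (X : topologicalType) : Prop :=
  regular_space X /\ accessible_space X.

(** W has order type omega_1, the least uncountable ordinal. *)
Definition is_omega1 {d : Order.disp_t} (W : orderType d) : Prop :=
  [/\ well_order (<=%O : rel W),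
      ~ countable [set: W] &
      forall a : W, countable [set b : W | b < a]].

Section ClubF.
Context {d : Order.disp_t} {W : orderType d}.

(** The nonzero limit ordinals. *)
Definition acc : set W :=
  [set a | (exists b, b < a) /\ forall b, b < a -> exists c, b < c < a].

Definition unbounded_in (a : W) (B : set W) : Prop :=
  B `<=` [set b | b < a] /\ forall b, b < a -> exists2 c, B c & b < c.

Definition clubF (A : W -> nat -> set W) : Prop :=
  (forall a n, acc a -> unbounded_in a (A a n)) /\
  (forall f : W -> nat, exists a n m,
    [/\ acc a, (f @^-1` [set n]) a & A a m `<=` f @^-1` [set n]]).

End ClubF.

(* Main.v *)
(** Choose for every limit [a] a cofinal increasing [omega]-sequence [s a] below
    [a] that meets each [A a m] cofinally, and call [U] open when for each limit
    [a] in [U] the sequence [s a] is eventually in [U]. This refines the order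
    topology. Glueing clopen neighbourhoods of the points [s a k] inside
    pairwise disjoint intervals gives, by induction on [a], a clopen base at
    [a]. A point of guessing for [f] together with a sequence of [A a m]
    converging to it is a monochromatic [omega + 1]. The space has no copy of
    [omega ^ 2 + 1] at all: in each row converging to a point other than the top
    point [p] one could pick a point outside [s p], and the set of these points
    would be closed although it accumulates at [p]. *)
Require Import Defs.
From mathcomp Require Import all_boot all_order.
From mathcomp Require Import boolp classical_sets functions cardinality.
From mathcomp Require Import interval topology.
From mathcomp Require wochoice.

Local Open Scope classical_set_scope.
Local Open Scope order_scope.

Import Order.TTheory.

Lemma well_order_ind {d : Order.disp_t} {W : orderType d} (P : W -> Prop) :
  wochoice.well_order (<=%O : rel W) ->
  (forall a, (forall b, b < a -> P b) -> P a) -> forall a, P a.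
Proof.
move=> wo IH a; apply: contrapT => nPa.
have [|z [[/asboolP nPz zmin] _]] := wo [pred x | `[< ~ P x >]].
  by exists a; apply/asboolP.
apply: nPz; apply: IH => b ltbz; apply: contrapT => nPb.
by have := zmin b (introT (asboolP _) nPb); rewrite leNgt ltbz.
Qed.

(** * Open sets of the ladder topology and clopen bases *)

Section LadderTopology.
Local Open Scope classical_set_scope.
Context {d : Order.disp_t} {W : orderType d} (s : W -> nat -> W).

Definition is_ladder_system : Prop := forall a, acc a ->
  [/\ {homo s a : i j / (i < j)%N >-> i < j},
      forall k, s a k < a &
      forall b, b < a -> exists k, b < s a k].

Definition ladder_open : set (set W) :=
  [set U | forall a, U a -> acc a -> exists n, forall k, (n <= k)%N -> U (s a k)].

Lemma ladder_openT : ladder_open setT.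
Proof. by move=> a _ _; exists 0%N. Qed.

Lemma ladder_openI (U V : set W) :
  ladder_open U -> ladder_open V -> ladder_open (U `&` V).
Proof.
move=> oU oV a [Ua Va] acca.
have [m mU] := oU a Ua acca; have [n nV] := oV a Va acca.
by exists (maxn m n) => k; rewrite geq_max => /andP[? ?]; split; auto.
Qed.

Lemma ladder_open_local (V : set W) :
  (forall x, V x -> exists G, [/\ ladder_open G, G x & G `<=` V]) ->
  ladder_open V.
Proof.
move=> loc a Va acca; have [G [oG Ga GV]] := loc a Va.
by have [n nG] := oG a Ga acca; exists n => k /nG/GV.
Qed.

Lemma ladder_open_bigU (F : set (set W)) :
  F `<=` ladder_open -> ladder_open (\bigcup_(U in F) U).
Proof.
move=> Fop; apply: ladder_open_local => x [U FU Ux].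
by exists U; split => //; [apply: Fop | move=> y ?; exists U].
Qed.

Definition ladder_topology : topology_on W :=
  TopologyOn ladder_openT ladder_openI ladder_open_bigU.

Hypothesis sL : is_ladder_system.

Lemma ladder_tail (a b : W) : acc a -> b < a ->
  exists n, forall k, (n <= k)%N -> b < s a k.
Proof.
move=> /sL[smono _ scof] /scof[n bn]; exists n => k.
by rewrite leq_eqVlt => /orP[/eqP <- //|/smono]; apply: lt_trans.
Qed.

Lemma ladder_open_down (U : set W) :
  (forall x y, x <= y -> U y -> U x) -> ladder_open U.
Proof.
move=> down a Ua /sL[_ slt _]; exists 0%N => k _.
exact: down (ltW (slt k)) Ua.
Qed.

Lemma ladder_open_gt (b : W) : ladder_open [set x | b < x].
Proof. by move=> a ba acca; exact: ladder_tail. Qed.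

(** Only finitely many bounds are involved, so their thresholds have a maximum; an [h i] that is not
    below [a] imposes nothing. *)
Lemma ladder_eventually_gt (h : nat -> W) (n : nat) (a : W) : acc a ->
  exists m, forall k, (m <= k)%N -> forall i, (i < n)%N -> h i < a -> h i < s a k.
Proof.
move=> acca; elim: n => [|n [m IH]]; first by exists 0%N.
have [lt_hna|le_ahn] := ltP (h n) a; last first.
  exists m => k /IH lt_hk i; rewrite ltnS leq_eqVlt => /orP[/eqP ->|/lt_hk //].
  by rewrite ltNge le_ahn.
have [p hp] := ladder_tail _ _ acca lt_hna.
exists (maxn m p) => k; rewrite geq_max => /andP[/IH lt_hk /hp lt_hnk] i.
by rewrite ltnS leq_eqVlt => /orP[/eqP ->|/lt_hk].
Qed.

(** The lower end of an interval is encoded by finitely many bounds, so that [n = 0] gives the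
    interval below the first rung of a ladder. *)
Lemma ladder_open_above (h : nat -> W) (n : nat) :
  ladder_open [set x | forall i, (i < n)%N -> h i < x].
Proof.
move=> a ha acca; have [m hm] := ladder_eventually_gt h n a acca.
by exists m => k /hm hk i lt_in; apply: hk => //; apply: ha.
Qed.

(** Below [p], a sequence converging to [p] in the order topology is closed
    and discrete in the ladder topology. *)
Lemma ladder_open_avoid (p : W) (h : nat -> W) :
  (forall b, b < p -> exists n, forall k, (n <= k)%N -> b < h k) ->
  forall b, b < p ->
  ladder_open [set x | x <= b /\ (range h x -> x = b)].
Proof.
move=> hp b ltbp x [xb hx] accx.
have ltxp := le_lt_trans xb ltbp.
(* From [m] on no rung of [x] lies in [range h]: for [n <= i] the point [h i] is above [x], and for
   [i < n] an [h i] below [x] is already exceeded. *)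
have [n hn] := hp x ltxp; have [m hm] := ladder_eventually_gt h n x accx.
have [_ slt _] := sL x accx.
exists m => k /hm hk; split; first exact: le_trans (ltW (slt k)) xb.
move=> [i _ hi]; have [/hn|lt_in] := leqP n i; rewrite ?hi.
  by rewrite ltNge ltW.
by have := hk i lt_in; rewrite hi slt ltxx => /(_ isT).
Qed.

(** Below [p] this is [ladder_open_avoid], above [p] an upper ray, and at [p] the ladder of [p]
    misses the range by assumption. *)
Lemma ladder_open_setC_range (p : W) (h : nat -> W) :
  (forall k, h k < p) ->
  (forall b, b < p -> exists n, forall k, (n <= k)%N -> b < h k) ->
  (acc p -> forall k, ~ range h (s p k)) ->
  ladder_open (~` range h).
Proof.
move=> hlt hp hs; apply: ladder_open_local => x nhx.
have [ltxp|ltpx|eqxp] := ltgtP x p.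
- exists [set y | y <= x /\ (range h y -> y = x)]; split => //.
    exact: ladder_open_avoid ltxp.
  by move=> y [_ hy] rhy; apply: nhx; rewrite -(hy rhy).
- exists [set y | p < y]; split => //; first exact: ladder_open_gt.
  by move=> y /= ltpy [k _ hk]; have := lt_trans (hlt k) ltpy; rewrite hk ltxx.
- exists (~` range h `&` [set y | y <= p]); split.
  + move=> y [nhy /=]; rewrite le_eqVlt => /orP[/eqP -> accp|ltyp accy].
      have [_ slt _] := sL p accp.
      by exists 0%N => k _; split; [exact: hs | exact/ltW].
    have [n nk] :=
        ladder_open_avoid p h hp y ltyp y (conj (lexx y) (fun=> erefl)) accy.
    exists n => k /nk[le_sky hk]; split => [rh|]; last first.
      exact: le_trans le_sky (ltW ltyp).
    by apply: nhy; rewrite -(hk rh).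
  + by split; rewrite //= eqxp.
  + by move=> y [].
Qed.

Definition ladder_clopen (V : set W) := ladder_open V /\ ladder_open (~` V).

(** Openness is a condition at limits only, so the singleton is vacuously open; its complement is
    covered by initial and final rays. *)
Lemma ladder_clopen_set1 (a : W) : ~ acc a -> ladder_clopen [set a].
Proof.
move=> nacca; split; first by move=> x -> /nacca.
apply: ladder_open_local => x /= /eqP/lt_total/orP[ltxa|ltax].
  exists [set y | y <= x]; split => //=.
    by apply: ladder_open_down => y z /= le_yz; apply: le_trans.
  by move=> y /= leyx eya; move: ltxa; rewrite ltNge -eya leyx.
exists [set y | a < y]; split => //; first exact: ladder_open_gt.
by move=> y /= + eya; rewrite eya ltxx.
Qed.

(** The bound [x <= a] in the conclusion keeps the neighbourhood of each rung inside its own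
    interval during the induction. *)
Lemma ladder_clopen_base (a : W) (U : set W) :
  wochoice.well_order (<=%O : rel W) -> ladder_open U -> U a ->
  exists V, [/\ ladder_clopen V, V a, V `<=` U & forall x, V x -> x <= a].
Proof.
move=> wo; move: a U; apply: (well_order_ind _ wo) => a IH U oU Ua.
have [acca|nacca] := pselect (acc a); last first.
  exists [set a]; split => //; first exact: ladder_clopen_set1.
    by move=> x ->.
  by move=> x ->.
have [smono slt scof] := sL a acca.
have [n nU] := oU a Ua acca.
(* For [n <= k] the set [V k] lies above all earlier rungs and not above [s a k], which makes these
   sets disjoint; below [n] the value [set0] is a default. *)
have /choice[V VP] : forall k, exists V, (n <= k)%N ->
    [/\ ladder_clopen V, V (s a k), V `<=` U &
        forall x, V x -> x <= s a k /\ forall i, (i < k)%N -> s a i < x].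
  move=> k; have [nk|] := leqP n k; last by exists set0.
  have oUk := ladder_openI _ _ oU (ladder_open_above (s a) k).
  have [|V [? ? VU Vle]] := IH (s a k) (slt k) _ oUk.
    by split; [exact: nU | move=> i /smono].
  exists V; split => // x Vx; last by split; [exact: Vle | case: (VU x Vx)].
  by case: (VU x Vx).
exists [set x | x = a \/ exists2 k, (n <= k)%N & V k x]; split.
- split.
    move=> x [-> _|[k nk Vkx] accx].
      by exists n => k nk; right; exists k => //; case: (VP k nk).
    have [[oV _] _ _ _] := VP k nk; have [m mV] := oV x Vkx accx.
    by exists m => i /mV ?; right; exists k.
  apply: ladder_open_local => x /not_orP[/eqP/lt_total/orP[ltxa|ltax] nV].
  (* For the least [j] with [x <= s a j], the interval around [x] can meet only [V j], which is
     closed and gets cut out. *)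
  + have [j0 ltxj0] := scof x ltxa.
    have exj : exists j, x <= s a j by exists j0; exact: ltW.
    case: (ex_minnP exj) => j le_xj jmin.
    have ltjx i : (i < j)%N -> s a i < x.
      by move=> lt_ij; rewrite ltNge; apply/negP => /jmin; rewrite leqNgt lt_ij.
    exists ([set y | y <= s a j] `&` [set y | forall i, (i < j)%N -> s a i < y]
      `&` (if (n <= j)%N then ~` V j else setT)); split.
    * apply: ladder_openI; last first.
        by case: ifP => [/VP[[]]|_] //; exact: ladder_openT.
      apply: ladder_openI; last exact: ladder_open_above.
      by apply: ladder_open_down => y z /= le_yz; apply: le_trans.
    * by split => //; case: ifP => // nj Vjx; apply: nV; exists j.
    * move=> y [[/= le_yj ltjy] nVy] [eya|[k nk Vky]].
        by move: le_yj; rewrite leNgt eya slt.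
      have [_ _ _ /(_ _ Vky)[le_yk ltky]] := VP k nk.
      have [lt_kj|lt_jk|eqkj] := ltngtP k j.
      - by have := ltjy k lt_kj; rewrite ltNge le_yk.
      - by have := ltky j lt_jk; rewrite ltNge le_yj.
      - by move: nVy; rewrite -eqkj nk.
  + exists [set y | a < y]; split => //; first exact: ladder_open_gt.
    move=> y /= ltay [eya|[k nk Vky]]; first by move: ltay; rewrite eya ltxx.
    have [_ _ _ /(_ _ Vky)[le_yk _]] := VP k nk.
    by have := lt_trans ltay (le_lt_trans le_yk (slt k)); rewrite ltxx.
- by left.
- by move=> x [->//|[k /VP[_ _ VU _] /VU]].
- move=> x [->//|[k /VP[_ _ _ Vle] /Vle[le_xk _]]].
  exact: le_trans le_xk (ltW (slt k)).
Qed.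

End LadderTopology.

(** * Left neighbourhoods in order topologies and the order of [omega ^ 2 + 1] *)

Lemma order_nbhs_left {d : Order.disp_t} {T : orderTopologicalType d}
    (x c : T) (U : set T) :
  nbhs x U -> c < x -> exists2 a, a < x & forall y, a < y -> y <= x -> U y.
Proof.
rewrite itv_nbhsE => -[[l r] [oi xi] iU] ltcx.
have rP y : y <= x -> y \in Interval (BInfty T true) r.
  move=> le_yx; move: xi oi; rewrite !itv_boundlr /= => /andP[_ xr] _.
  by apply: le_trans xr; rewrite bnd_simp.
case: l oi xi iU rP => [[] l|[]] oi xi iU rP.
- by case: r oi {xi iU rP} => [[]|[]].
- exists l; first by move: xi; rewrite itv_boundlr /= bnd_simp => /andP[].
  move=> y ltly le_yx; apply: iU => /=; rewrite itv_boundlr bnd_simp ltly /=.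
  by have := rP y le_yx; rewrite /= itv_boundlr.
(* An interval unbounded to the left receives [c] as its left bound. *)
- by exists c => // y _ le_yx; apply: iU; exact: rP.
- by move: xi; rewrite itv_boundlr => /andP[].
Qed.

Lemma osucc_Some_lt {d : Order.disp_t} {T : orderType d} (a b : T) :
  ((Some a : osucc T) < Some b) = (a < b).
Proof. by rewrite !ltNge. Qed.

Lemma omega_sq_plus_1_lt (k i k' i' : nat) :
  ((Some ((k, i) : nat *l nat) : omega_sq_plus_1) <
    Some ((k', i') : nat *l nat)) = (k < k')%N || ((k == k') && (i < i')%N).
Proof.
rewrite osucc_Some_lt Order.ProdLexiOrder.ltEprodlexi /= !leEnat ltEnat /=.
by case: (ltngtP k k').
Qed.

(** * Separation, and the absence of [omega ^ 2 + 1] *)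

Section LadderSpace.
Local Open Scope classical_set_scope.
Context {d : Order.disp_t} {W : orderType d} (s : W -> nat -> W).
Hypothesis sL : is_ladder_system s.
Local Notation X := (space (ladder_topology s)).

Lemma nbhs_ladder_open (x : X) (U : set X) : ladder_open s U -> U x -> nbhs x U.
Proof. by move=> oU Ux; exists U; split. Qed.

Lemma ladder_accessible : accessible_space X.
Proof.
move=> x y /lt_total/orP[ltxy|ltyx].
  exists [set z : W | z <= x]; split; last by rewrite inE /= leNgt ltxy.
    by apply: (ladder_open_down _ sL) => u v /= ?; apply: le_trans.
  by rewrite inE /=.
exists [set z : W | y < z]; split; last by rewrite inE /= ltxx.
  exact: (ladder_open_gt _ sL).
by rewrite inE.
Qed.

Lemma ladder_regular :
  wochoice.well_order (<=%O : rel W) -> regular_space X.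
Proof.
move=> wo a U [V [oV Va VU]].
have [V' [[oV' cV'] V'a V'V _]] := ladder_clopen_base s sL a V wo oV Va.
exists V'; first exact: nbhs_ladder_open.
have /closure_id <- : closed (V' : set X) by rewrite -openC.
exact: subset_trans VU.
Qed.

Lemma ladder_no_omega_sq (phi : order_topology omega_sq_plus_1 -> X) :
  injective phi -> ~ continuous phi.
Proof.
move=> phiI phiC.
(* [pt k i] is the ordinal [omega * k + i], so row [k] converges to [pt k.+1 0]. *)
pose pt (k i : nat) : order_topology omega_sq_plus_1 := Some ((k, i) : nat *l nat).
have pt_lt k i k' i' :
    (pt k i < pt k' i') = (k < k')%N || ((k == k') && (i < i')%N).
  exact: omega_sq_plus_1_lt.
pose top : order_topology omega_sq_plus_1 := None.
pose p := phi top.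
have top_tail U : ladder_open s U -> U p ->
    exists n, forall k i, (n <= k)%N -> U (phi (pt k i)).
  move=> oU Up; have nU : nbhs top (phi @^-1` U).
    by apply: phiC; exact: nbhs_ladder_open.
  have [[[k0 i0]|] // _ aU] := order_nbhs_left top (pt 0 0) _ nU isT.
  exists k0.+1 => k i lt_k; apply: aU; last by [].
  by rewrite pt_lt lt_k.
have row_tail k U : ladder_open s U -> U (phi (pt k.+1 0)) ->
    exists i, U (phi (pt k i)).
  move=> oU Uq; have nU : nbhs (pt k.+1 0) (phi @^-1` U).
    by apply: phiC; exact: nbhs_ladder_open.
  have [|[[k0 i0]|] lt_a aU] := order_nbhs_left _ (pt 0 0) _ nU.
  - by rewrite pt_lt.
  (* The left bound [(k0, i0)] is below [(k.+1, 0)], hence [k0 <= k] and [(k, i0.+1)] lies beyond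
     it. *)
  - exists i0.+1; move: lt_a; rewrite pt_lt ltn0 andbF orbF ltnS leq_eqVlt orbC.
    move=> le_k; apply: aU; last by apply: ltW; rewrite pt_lt ltnSn.
    by rewrite pt_lt ltnSn andbT.
  - by [].
have phi_neq k i : phi (pt k i) <> p by move=> /phiI.
(* Otherwise [[set p]] would be open and contain the images of whole rows. *)
have accp : acc p.
  apply: contrapT => nacc; have [oa _] := ladder_clopen_set1 s sL _ nacc.
  have [n /(_ n 0%N (leqnn n))] := top_tail _ oa erefl.
  exact: phi_neq.
have [n0 n0P] : exists n, forall k i, (n <= k)%N -> (phi (pt k i) : W) < p.
  have [||n nP] := top_tail [set x | x <= p]; rewrite /=.
  - by apply: (ladder_open_down _ sL) => x y /=; apply: le_trans.
  - exact: lexx.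
  exists n => k i /(nP k i) /=; rewrite le_eqVlt => /orP[/eqP|//].
  by move/phi_neq.
(* The limit [q] of the row is below [p], so it has a neighbourhood meeting the ladder of [p] at
   most in [q]; by injectivity no point of the row is sent to [q]. *)
have /choice[i iP] : forall k, exists i, ~ range (s p) (phi (pt (n0 + k) i)).
  move=> k.
  have ltqp := (n0P (n0 + k).+1 0%N (leqW (leq_addr _ _))).
  have := ladder_open_avoid s sL p _ (fun b => ladder_tail s sL _ b accp) _ ltqp.
  move=> /(row_tail (n0 + k)%N)[|i [_ ih]]; first by split => /=.
  exists i => /ih /phiI [/eqP].
  by rewrite ltn_eqF.
pose h k : W := phi (pt (n0 + k) (i k)).
have oh : ladder_open s (~` range h).
  apply: (ladder_open_setC_range _ sL p).
  - by move=> k; apply: n0P; exact: leq_addr.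
  - move=> b ltbp; have [n nP] := top_tail _ (ladder_open_gt _ sL b) ltbp.
    by exists n => k nk; apply: nP; rewrite (leq_trans nk) ?leq_addl.
  - by move=> _ k [j _ hj]; apply: (iP j); exists k.
(* The open complement of [range h] contains [p], hence all late rows, including the chosen point
   [h n]. *)
have [|n /(_ (n0 + n)%N (i n) (leq_addl _ _))] := top_tail _ oh.
  by move=> [k _ /phi_neq].
by apply; exists n.
Qed.

End LadderSpace.

(** * Cofinal sequences meeting countably many unbounded sets *)

Section CofinalSequence.
Local Open Scope classical_set_scope.
Context {d : Order.disp_t} {W : orderType d}.

(** [s] runs through the pairs [(m, b)] with [b < a], each time picking an
    element of [S m] above [b] and above the previous value. *)
Lemma cofinal_sequence (a : W) (S : nat -> set W) :
  countable [set b : W | b < a] -> acc a -> (forall m, unbounded_in a (S m)) ->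
  exists s : nat -> W,
    [/\ {homo s : i j / (i < j)%N >-> i < j},
        forall k, exists m, S m (s k) &
        forall m b, b < a -> exists k, S m (s k) /\ b < s k].
Proof.
move=> cnt [[b0 ltb0] _] Sunb.
have /pfcard_geP[D0|[e]] : countable ([set: nat] `*` [set b : W | b < a]).
    by apply: countableX.
  by have : (@set0 (nat * W)) (0%N, b0) by rewrite -D0.
have /choice[N NP] : forall kx : nat * W, exists y, kx.2 < a ->
    [/\ S (e kx.1).1 y, kx.2 < y & (e kx.1).2 < a -> (e kx.1).2 < y].
  move=> [k x] /=; have [ltxa|] := ltP x a; last by move=> *; exists x.
  have [_ Sc] := Sunb (e k).1; have [ltea|leae] := ltP (e k).2 a.
    have [|y Sy] := Sc (Order.max x (e k).2); first by rewrite gt_max ltxa.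
    by rewrite gt_max => /andP[? ?]; exists y.
  by have [y ? ?] := Sc x ltxa; exists y.
pose t := fix t k := if k is k'.+1 then N (k', t k') else b0.
have ta k : t k < a.
  elim: k => //= k IH; have [Sy _ _] := NP (k, t k) IH.
  by have [Sa _] := Sunb (e k).1; exact: Sa.
(* The shift drops the starting value [b0], which may lie in no [S m]. *)
exists (fun k => t k.+1); split.
- apply: homo_ltn => [x y z|k]; first exact: lt_trans.
  by have [] := NP (k.+1, t k.+1) (ta _).
- by move=> k; exists (e k).1; have [] := NP (k, t k) (ta k).
- move=> m b ltba; have [k _ ek] : (e @` [set: nat]) (m, b) by apply: surj.
  by exists k; have := NP (k, t k) (ta k); rewrite /= ek => -[? _ /(_ ltba)].
Qed.

End CofinalSequence.

(** * Copies of [omega + 1] from convergent sequences *)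

Section ConvergentSequence.
Local Open Scope classical_set_scope.
Context {d : Order.disp_t} {W : orderType d} (s : W -> nat -> W).
Hypothesis sL : is_ladder_system s.
Local Notation X := (space (ladder_topology s)).
Local Notation O := (order_topology omega_plus_1).

(** Each [t k] is isolated in the subspace, as is [Some k] in [omega + 1]. At the top, rays above
    [t k] give continuity one way and convergence of [t] the other. *)
Lemma convergent_omega_plus_1 (a : W) (t : nat -> W) :
  {homo t : i j / (i < j)%N >-> i < j} -> (forall k, t k < a) ->
  (t : nat -> X) @ \oo --> (a : X) ->
  homeomorphic ([set x | x = a \/ range t x] : set X)
    (O).
Proof.
move=> tmono tlt tcvg; pose Y : set X := [set x | x = a \/ range t x].
change (homeomorphic Y (O)).
pose G (z : O) : X := if z is Some k then t k else a.
have GY z : Y (G z) by case: z => [k|]; [right; exists k | left].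
have t_inj : injective t.
  by move=> i j tij; case: (ltngtP i j) => // /tmono; rewrite tij ltxx.
have G_inj : injective G.
  move=> [i|] [j|] //= => [/t_inj -> //|e|e].
    by have := tlt i; rewrite e ltxx.
  by have := tlt j; rewrite -e ltxx.
have /choice[f fP] : forall y : Y,
    exists z : O, G z = set_val y.
  move=> [x xY]; rewrite set_valE /=.
  by have [->|[k _ <-]] := set_mem xY; [exists None | exists (Some k)].
pose g z : Y := SigSub (mem_set (GY z)).
have fK : cancel f g by move=> y; apply: val_inj; exact: fP.
have gK : cancel g f by move=> z; apply: G_inj; rewrite fP.
have nbhsY (y : Y) U : ladder_open s U -> U (set_val y) ->
    nbhs y (set_val @^-1` U).
  move=> oU Uy; apply: (@initial_continuous Y X set_val).
  exact: nbhs_ladder_open.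
have itv1 k : nbhs (Some k : O) [set Some k].
  have -> : [set Some k] = [set z : O |
      z < (Some k.+1 : O) /\ forall i, (i < k)%N -> (Some i : O) < z].
    rewrite predeqE => -[j|]; split=> //=; last by move=> [].
    - by move=> [->]; split=> [|i]; rewrite osucc_Some_lt ltEnat /= ?ltnSn.
    - move=> [+ +]; rewrite osucc_Some_lt ltEnat /= ltnS leq_eqVlt => /orP[/eqP -> //|lt_jk].
      by move=> /(_ j lt_jk); rewrite ltxx.
  apply: (filterI (F := nbhs (Some k : O))).
    apply: filterS (open_nbhs_nbhs (conj (lray_open (Some k.+1 : O)) _)).
      by move=> z; rewrite /= in_itv; apply.
    by rewrite /= in_itv /= osucc_Some_lt ltEnat /= ltnSn.
  case: k => [|k]; first exact: filterS filterT.
  apply: filterS (open_nbhs_nbhs (conj (rray_open (Some k : O)) _)).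
    move=> z; rewrite /= in_itv /= andbT => ltkz i; rewrite ltnS => le_ik.
    by apply: le_lt_trans ltkz.
  by rewrite /= in_itv /= andbT osucc_Some_lt ltEnat /= ltnSn.
exists f, g; split => //.
- move=> y U; rewrite -[y]fK; move: (f y) => {}y; rewrite gK.
  case: y => [k|] Uz.
    apply: filterS (nbhsY (g (Some k))
      ([set x | x <= t k] `&` [set x | forall i, (i < k)%N -> t i < x]) _ _).
    + move=> y; rewrite -[y]fK; move: (f y) => {}y /= [].
      rewrite gK; case: y => [j|]; last by rewrite /= leNgt tlt.
      move=> /= le_jk ltj; have [/ltj|/tmono|->] := ltngtP j k.
      * by rewrite ltxx.
      * by rewrite ltNge le_jk.
      * exact: nbhs_singleton Uz.
    + apply: ladder_openI; last exact: (ladder_open_above _ sL).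
      by apply: (ladder_open_down _ sL) => x y /= ?; apply: le_trans.
    + by split => //= i /tmono.
  have [[k|] // _ kU] := order_nbhs_left _ (Some 0%N : O) _ Uz isT.
  apply: filterS (nbhsY (g None) [set x | t k < x] _ _) => //=.
    move=> y; rewrite -[y]fK; move: (f y) => {}y; rewrite /= gK => ltky.
    apply: kU; last by case: y {ltky}.
    case: y ltky => //= j ltkj; rewrite osucc_Some_lt ltEnat /=.
    case: (ltngtP k j) ltkj => // [/tmono/lt_trans h /h|->]; by rewrite ltxx.
  exact: (ladder_open_gt _ sL).
- apply: (@continuous_comp_initial _ _ X set_val) => -[k|] U Uz.
    by apply: filterS (itv1 k) => _ ->; exact: nbhs_singleton Uz.
  have [n _ nU] := tcvg U Uz.
  apply: filterS (open_nbhs_nbhs (conj (rray_open (Some n : O)) _)).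
    move=> [k|_]; last exact: nbhs_singleton Uz.
    by rewrite /= in_itv /= andbT osucc_Some_lt => /ltnW/nU.
  by rewrite /= in_itv.
Qed.

End ConvergentSequence.

(** * Choice of the ladders and verification of the properties *)

Theorem theorem4p1 (d : Order.disp_t) (W : orderType d) (hW : is_omega1 W)
    (A : W -> nat -> set W) (hA : clubF A) :
  exists tau : topology_on W,
    [/\ regular_T1 (space tau),
        top_arrow (space tau) omega_plus_1,
        ~ top_arrow (space tau) omega_sq_plus_1 &
        forall (a : W) (m : nat), acc a ->
          exists s : nat -> W,
            [/\ {homo s : i j / (i < j)%N >-> i < j},
                forall k, A a m (s k) &
                (s : nat -> space tau) @ \oo --> (a : space tau)]].
Proof.
have [wo _ cnt] := hW; have [Aunb AF] := hA.
have /choice[s sP] : forall a, exists s : nat -> W, acc a ->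
    [/\ {homo s : i j / (i < j)%N >-> i < j},
        forall k, exists m, A a m (s k) &
        forall m b, b < a -> exists k, A a m (s k) /\ b < s k].
  (* Outside [acc] the constant sequence is a default value. *)
  move=> a; have [acca|nacca] := pselect (acc a); last by exists (fun=> a).
  have [s sP] := cofinal_sequence a (A a) (cnt a) acca (fun m => Aunb a m acca).
  by exists s.
have sL : is_ladder_system s.
  move=> a acca; have [smono sA scof] := sP a acca; split => //.
    by move=> k; have [m Am] := sA k; have [Aa _] := Aunb a m acca; exact: Aa.
  by move=> b /(scof 0%N)[k [_ ltb]]; exists k.
have seqA (a : W) (m : nat) : acc a -> exists t : nat -> W,
    [/\ {homo t : i j / (i < j)%N >-> i < j},
        forall k, A a m (t k) &
        (t : nat -> space (ladder_topology s)) @ \oo -->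
          (a : space (ladder_topology s))].
  move=> acca; have [smono _ scof] := sP a acca; have [_ slt _] := sL a acca.
  (* [A a m] meets the ladder of [a] cofinally, so an increasing [t] can be drawn from the
     intersection; as a subsequence of [s a] it converges to [a]. *)
  have [|t [tmono tP _]] := cofinal_sequence a
      (fun=> [set x | A a m x /\ range (s a) x]) (cnt a) acca.
    move=> _; split; first by move=> x [_ [k _ <-]]; exact: slt.
    by move=> b /(scof m)[k [Am ltb]]; exists (s a k) => //; split => //; exists k.
  exists t; split => // [k|U]; first by have [_ []] := tP k.
  move=> [V [oV Va VU]]; have [n nV] := oV a Va acca.
  have /choice[i iP] : forall k, exists j, s a j = t k.
    by move=> k; have [_ [_ [j _ sj]]] := tP k; exists j.
  have imono : {homo i : k l / (k < l)%N}.
    move=> k l /tmono; rewrite -!iP; case: (ltngtP (i k) (i l)) => //.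
      by move=> /smono/lt_trans h /h; rewrite ltxx.
    by move=> ->; rewrite ltxx.
  have le_i k : (k <= i k)%N.
    by elim: k => // k IH; exact: leq_ltn_trans IH (imono _ _ (ltnSn k)).
  exists n => // k /= nk; apply: VU; rewrite -iP; apply: nV.
  exact: leq_trans (le_i k).
exists (ladder_topology s); split => //.
- by split; [exact: ladder_regular | exact: ladder_accessible].
- move=> f; have [a [n [m [acca fa fA]]]] := AF f.
  have [t [tmono tA tcvg]] := seqA a m acca.
  exists n, [set x | x = a \/ range t x]; split.
    by move=> x [->//|[k _ <-]]; exact: fA.
  apply: convergent_omega_plus_1 => // k.
  by have [Aa _] := Aunb a m acca; exact: Aa.
(* A constant colouring suffices: any copy would give a continuous injection, namely [g] followed by
   the inclusion of [Y]. *)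
- move=> /(_ (fun=> 0%N))[_ [Y [_ [f [g [_ gK _ gC]]]]]].
  apply: (ladder_no_omega_sq s sL (set_val \o g)).
    by apply: inj_comp; [exact: val_inj | exact: can_inj gK].
  move=> x; apply: continuous_comp; first exact: gC.
  exact: initial_continuous.
Qed.
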